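(* Let $d,n\in\mathbb{N}$, $N=(n+1)^d$, $\mu\in\mathcal{M}$, let $V\subseteq\mathbb{T}^d$ be the Zariski closure of $\operatorname{supp}\mu$, and suppose $V(\ker T_n)=V$. Then $p_{0,n}(x)+p_{1,n}(x)=1$ for all $x\in\mathbb{T}^d$. In particular, $$p_{1,n}(x)\begin{cases}=1,&\text{if }x\in V,\\<1,&\text{otherwise.}\end{cases}$$ If $V\subsetneq\mathbb{T}^d$, then for all $x\in\mathbb{T}^d$ the variational characterization $$p_{0,n}(x)=\max_{p}\frac{|p(x)|^2}{N\,\|p\|_{L^2}^2}$$ holds, where the maximum is over all trigonometric polynomials $p\in\langle e^{2\pi i kx}:k\in[n]\rangle$ (complex linear span), $p\neq0$, such that $p(y)=0$ for all $y\in V$.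
   Context: $\mathbb{N}=\{1,2,\dots\}$, $\mathbb{T}^d=[0,1)^d$ is the torus, $kx=k_1x_1+\dots+k_dx_d$, $[n]=\{0,\dots,n\}^d$. $\mathcal{M}$ is the set of complex Borel measures $\mu$ on $\mathbb{T}^d$ of finite total variation with $\mu(\mathbb{T}^d)=1$. The trigonometric moments are $\hat\mu(k)=\int_{\mathbb{T}^d}e^{-2\pi i kx}\,\mathrm{d}\mu(x)$ and the moment matrix is $T_n=(\hat\mu(k-\ell))_{k,\ell\in[n]}\in\mathbb{C}^{N\times N}$, with singular value decomposition $T_n=U_n\Sigma_nV_n^*$, singular values $\sigma^{(n)}_1\ge\dots\ge\sigma^{(n)}_N\ge0$, and $r=\operatorname{rank}T_n$. With $e_n(x)=(e^{-2\pi i kx})_{k\in[n]}$ and $u_j^{(n)}(x)$ the $j$-th entry of $e_n(x)^*U_n$, define $$p_{1,n}(x)=\frac1N\sum_{j=1}^r|u_j^{(n)}(x)|^2,\qquad p_{0,n}(x)=\frac1N\sum_{j=r+1}^N|u_j^{(n)}(x)|^2.$$ The Zariski closure $V$ of $\operatorname{supp}\mu$ is the smallest subset of $\mathbb{T}^d$ containing $\operatorname{supp}\mu$ that is the zero locus in $\mathbb{T}^d$ of a (possibly zero) trigonometric polynomial. A vector $p=(p_k)_{k\in[n]}\in\mathbb{C}^N$ is identified with the trigonometric polynomial $p(x)=\sum_{k\in[n]}p_ke^{2\pi i kx}$, and $V(\ker T_n)=\{x\in\mathbb{T}^d: p(x)=0\text{ for all }p\in\ker T_n\}$. *)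

(* Defs.v *)
From HB Require Import structures.
From mathcomp Require Import all_boot all_order all_algebra.
From mathcomp Require Import all_classical all_reals all_analysis.
From mathcomp Require Import complex.

Set Implicit Arguments.
Unset Strict Implicit.
Unset Printing Implicit Defensive.

Import Order.TTheory GRing.Theory Num.Theory.
Import numFieldNormedType.Exports.

Local Open Scope classical_set_scope.
Local Open Scope ring_scope.
Local Open Scope complex_scope.
Local Open Scope sesquilinear_scope.

(* The circle is the set [0,1), but its topology is that of R/Z: it is the
   quotient topology for t |-> t - floor t, not the subspace topology, so that
   points close to 1 are close to 0. *)
Definition circle (R : realType) : Type := {t : R | 0 <= t < 1}.

HB.instance Definition _ (R : realType) := Choice.on (circle R).

Lemma circle_proj_subproof (R : realType) (t : R) :
  0 <= t - (Num.floor t)%:~R < 1.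
Proof.
have /andP[h1 h2] := floor_itv t.
by rewrite subr_ge0 h1 ltrBlDl -[1]/(1%:~R) -intrD.
Qed.

Definition circle_proj (R : realType) (t : R) : circle R :=
  exist _ (t - (Num.floor t)%:~R) (circle_proj_subproof t).

HB.instance Definition _ (R : realType) :=
  isPointed.Build (circle R) (circle_proj 0).

Section circle_topology.
Variable R : realType.

Definition circle_open (A : set (circle R)) : Prop :=
  open (@circle_proj R @^-1` A).

Let circle_openT : circle_open setT.
Proof. by rewrite /circle_open preimage_setT; exact: openT. Qed.

Let circle_openI (A B : set (circle R)) :
  circle_open A -> circle_open B -> circle_open (A `&` B).
Proof. exact: openI. Qed.

Let circle_open_bigcup (I : Type) (F : I -> set (circle R)) :
  (forall i, circle_open (F i)) -> circle_open (\bigcup_i F i).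
Proof. by move=> oF; apply: bigcup_open => i _; exact: oF. Qed.

HB.instance Definition _ := isOpenTopological.Build (circle R)
  circle_openT circle_openI circle_open_bigcup.

End circle_topology.

HB.instance Definition _ (R : realType) :=
  Measurable.copy (circle R) (g_sigma_algebraType (@open (circle R))).

Lemma measurable_circle_proj (R : realType) :
  measurable_fun [set: measurableTypeR R] (@circle_proj R).
Proof.
apply: (@measurability _ _ _ _ _ _ (@open (circle R))) => //.
by move=> _ [A oA <-]; rewrite setTI; exact: measurable_realfun.open_measurable.
Qed.

Definition circle_proj_mfun (R : realType) :
    {mfun measurableTypeR R >-> circle R} :=
  HB.pack_for {mfun measurableTypeR R >-> circle R} (@circle_proj R)
    (isMeasurableFun.Build _ _ (measurableTypeR R) (circle R)
       (@circle_proj R) (@measurable_circle_proj R)).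

(* The library puts the product sigma-algebra on tuples; as the circle is
   second countable, this is the Borel sigma-algebra of the torus. *)
Definition torus (R : realType) (d : nat) : Type := d.-tuple (circle R).

HB.instance Definition _ (R : realType) (d : nat) := Measurable.on (torus R d).

Section torus_topology.
Variables (R : realType) (d : nat).

(* Product topology, presented as the library does for matrices. *)
Definition torus_nbhs (x : torus R d) : set_system (torus R d) :=
  filter_from [set U : 'I_d -> set (circle R) | forall i, nbhs (tnth x i) (U i)]
    (fun U => [set y : torus R d | forall i, U i (tnth y i)]).

HB.instance Definition _ := hasNbhs.Build (torus R d) torus_nbhs.

Let torus_nbhs_filter (x : torus R d) : ProperFilter (nbhs x).
Proof.
apply: (filter_from_proper (filter_from_filter _ _)) => [|U W xU xW|U xU].
- by exists (fun=> setT) => i; apply: filterT.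
- exists (fun i => U i `&` W i) => [i|y UWy]; first exact: filterI.
  by split=> i; have [] := UWy i.
- by exists x => i; apply: nbhs_singleton.
Qed.

Let torus_nbhs_singleton (x : torus R d) (A : set (torus R d)) :
  nbhs x A -> A x.
Proof. by move=> [U xU]; apply=> i; apply: nbhs_singleton. Qed.

Let torus_nbhs_nbhs (x : torus R d) (A : set (torus R d)) :
  nbhs x A -> nbhs x (nbhs^~ A).
Proof.
move=> [U xU UA]; exists (fun i => (U i)°).
  by move=> i; apply: nbhs_interior.
by move=> y Uy; exists U.
Qed.

HB.instance Definition _ := Nbhs_isNbhsTopological.Build (torus R d)
  torus_nbhs_filter torus_nbhs_singleton torus_nbhs_nbhs.

End torus_topology.

Section product_probability.
Context {d} {T : measurableType d} {R : realType}.

Definition cons_pair (n : nat) (z : T * n.-tuple T) : n.+1.-tuple T :=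
  [the n.+1.-tuple T of z.1 :: z.2].

Let measurable_cons_pair (n : nat) : measurable_fun [set: _] (@cons_pair n).
Proof. by apply: measurable_cons. Qed.

HB.instance Definition _ (n : nat) :=
  isMeasurableFun.Build _ _ _ _ (@cons_pair n) (@measurable_cons_pair n).

Fixpoint prob_power (P : probability T R) (n : nat) :
    probability (n.-tuple T) R :=
  match n with
  | 0 => [the probability _ _ of \d_([tuple] : 0.-tuple T)]
  | m.+1 => [the probability _ _ of
      distribution (P \x prob_power P m)%E (@cons_pair m)]
  end.

End product_probability.

(* uniform_prob is Lebesgue measure on [0,1]; the image of the null set {1} is
   the point 0 of the circle. *)
Definition lebesgue_circle (R : realType) : probability (circle R) R :=
  [the probability _ _ of
    distribution [the probability (measurableTypeR R) R of
                    uniform_prob (@ltr01 R)]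
                 (circle_proj_mfun R)].

Definition lebesgue_torus (R : realType) (d : nat) :
    probability (torus R d) R :=
  prob_power (lebesgue_circle R) d.

(* A complex measure, as a pair of finite signed measures; its total variation
   is automatically finite. *)
Record complex_measure d (T : measurableType d) (R : realType) :=
  ComplexMeasure {
    Re_measure : {charge set T -> \bar R} ;
    Im_measure : {charge set T -> \bar R} }.

Section complex_measure.
Context {d} {T : measurableType d} {R : realType}.

Definition cmeasure (mu : complex_measure T R) (A : set T) : R[i] :=
  fine (Re_measure mu A) +i* fine (Im_measure mu A).

Lemma hahn_sets_subproof (nu : {charge set T -> \bar R}) :
  exists PN : set T * set T, hahn_decomposition nu PN.1 PN.2.
Proof. by have [P [N PN]] := Hahn_decomposition nu; exists (P, N). Qed.

Definition hahn_setsP (nu : {charge set T -> \bar R}) :=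
  projT2 (cid (hahn_sets_subproof nu)).

Definition charge_integral (nu : {charge set T -> \bar R}) (f : T -> R) : R :=
  \int[jordan_pos (hahn_setsP nu)]_x f x
  - \int[jordan_neg (hahn_setsP nu)]_x f x.

Definition complex_integral (mu : complex_measure T R) (f : T -> R[i]) : R[i] :=
  (charge_integral (Re_measure mu) (fun x => complex.Re (f x))
   - charge_integral (Im_measure mu) (fun x => complex.Im (f x)))
  +i* (charge_integral (Re_measure mu) (fun x => complex.Im (f x))
   + charge_integral (Im_measure mu) (fun x => complex.Re (f x))).

End complex_measure.

(* x is in the support iff mu does not vanish identically on the measurable
   subsets of U (i.e. |mu|(U) > 0) for every neighbourhood U of x. *)
Definition msupport (R : realType) (d : nat)
    (mu : complex_measure (torus R d) R) : set (torus R d) :=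
  [set x | forall U, nbhs x U ->
    exists A, [/\ measurable A, A `<=` U & cmeasure mu A != 0]].

Section trigonometric_polynomials.
Variables (R : realType) (d : nat).

Definition dotk (k : 'I_d -> int) (x : torus R d) : R :=
  \sum_(i < d) (k i)%:~R * val (tnth x i).

(* e^{2 pi i k x} *)
Definition character (k : 'I_d -> int) (x : torus R d) : R[i] :=
  cos (2 * pi * dotk k x) +i* sin (2 * pi * dotk k x).

Definition trig_poly (f : torus R d -> R[i]) : Prop :=
  exists s : seq (R[i] * ('I_d -> int)),
    forall x, f x = \sum_(ck <- s) ck.1 * character ck.2 x.

Definition zero_locus (V : set (torus R d)) : Prop :=
  exists2 f, trig_poly f & V = [set x | f x = 0].

Definition zariski_closure (S V : set (torus R d)) : Prop :=
  [/\ S `<=` V, zero_locus V &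
      forall W, S `<=` W -> zero_locus W -> V `<=` W].

Definition moment (mu : complex_measure (torus R d) R) (k : 'I_d -> int) :
    R[i] :=
  complex_integral mu (character (fun i => - k i)).

End trigonometric_polynomials.

Section moment_matrix.
Variables (R : realType) (d n : nat).

Definition Nfreq : nat := (n.+1 ^ d)%N.

Lemma card_freq : #|{ffun 'I_d -> 'I_n.+1}| = Nfreq.
Proof. by rewrite card_ffun !card_ord. Qed.

(* Enumeration of [n] = {0,...,n}^d by the row/column indices j < N. *)
Definition freq (j : 'I_Nfreq) (i : 'I_d) : int :=
  (enum_val (cast_ord (esym card_freq) j) : {ffun 'I_d -> 'I_n.+1}) i : nat.

Definition moment_matrix (mu : complex_measure (torus R d) R) :
    'M[R[i]]_Nfreq :=
  \matrix_(k, l) moment mu (fun i => freq k i - freq l i).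

Definition evec (x : torus R d) : 'cV[R[i]]_Nfreq :=
  \col_k character (fun i => - freq k i) x.

(* The exponentials being linearly independent, poly_of p is the zero function
   iff p = 0. *)
Definition poly_of (p : 'cV[R[i]]_Nfreq) (x : torus R d) : R[i] :=
  \sum_k p k 0 * character (freq k) x.

Definition zeros_ker (T : 'M[R[i]]_Nfreq) : set (torus R d) :=
  [set x | forall p : 'cV[R[i]]_Nfreq, T *m p = 0 -> poly_of p x = 0].

Definition normL2 (p : 'cV[R[i]]_Nfreq) : R :=
  Num.sqrt (\int[lebesgue_torus R d]_x (Normc.normc (poly_of p x) ^+ 2)).

Definition usv (U : 'M[R[i]]_Nfreq) (j : 'I_Nfreq) (x : torus R d) : R[i] :=
  ((evec x) ^t* *m U) 0 j.

(* U is the matrix of left singular vectors of T; indices start from 0, so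
   j = 1, ..., r becomes j < r. *)
Definition p1 (T U : 'M[R[i]]_Nfreq) (x : torus R d) : R :=
  Nfreq%:R^-1 * \sum_(j < Nfreq | (j < \rank T)%N)
    Normc.normc (usv U j x) ^+ 2.

Definition p0 (T U : 'M[R[i]]_Nfreq) (x : torus R d) : R :=
  Nfreq%:R^-1 * \sum_(j < Nfreq | (\rank T <= j)%N)
    Normc.normc (usv U j x) ^+ 2.

End moment_matrix.

Definition is_svd (R : realType) (N : nat)
    (T U : 'M[R[i]]_N) (sigma : 'rV[R]_N) (W : 'M[R[i]]_N) : Prop :=
  [/\ U \is unitarymx, W \is unitarymx,
      (forall j, 0 <= sigma 0 j),
      (forall j k : 'I_N, (j <= k)%N -> sigma 0 k <= sigma 0 j) &
      T = U *m diag_mx (map_mx (fun s : R => s%:C) sigma) *m W ^t*].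

Definition is_max (R : realType) (A : set R) (m : R) : Prop :=
  A m /\ ubound A m.

(* Main.v *)
(** In the columns [U_j] of [U], with [r] the rank of [T], [ker T^*] is spanned
    by the [U_j] with [j >= r].  As [T] is a Toeplitz matrix, the map
    [p_k |-> conj(p_{(n, ..., n) - k})] exchanges [ker T] and [ker T^*]; on
    polynomials it is [p(x) |-> e^{2 pi i (n, ..., n) x} conj(p(x))], so both
    kernels have the same common zeros, namely [V].
    Conversely a polynomial that vanishes on the support of [mu] lies in
    [ker T], because [(T p)_k] is the integral of [e^{-2 pi i k x} p(x)], so
    [ker T^*] consists exactly of the polynomials vanishing on [V].  Hence
    [N p_0] is the squared norm of the evaluation at [x] on that space, and the
    variational characterization is Parseval's identity and the Cauchy-Schwarz
    inequality. *)

Require Import Defs.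
From mathcomp Require Import all_boot all_order all_algebra.
From mathcomp Require Import all_classical all_reals all_analysis.
From mathcomp Require Import complex.
From mathcomp Require Import ring lra.

Set Implicit Arguments.
Unset Strict Implicit.
Unset Printing Implicit Defensive.

Import Order.TTheory GRing.Theory Num.Theory.
Import numFieldNormedType.Exports.

Local Open Scope classical_set_scope.
Local Open Scope ring_scope.

(** * Integration of bounded measurable functions against charges and complex measures *)

Section bounded_measurable.
Context d (T : measurableType d) (R : realType).
Implicit Types (f g : T -> R) (nu : {charge set T -> \bar R}).

(** Such functions are integrable against every finite measure, in particular against both Jordan
    parts of a charge, so linearity of the integrals needs no separate integrability arguments. *)
Definition bounded_measurable f :=
  measurable_fun setT f /\ exists M, forall x, `|f x| <= M.

Lemma bounded_measurable_cst c : bounded_measurable (fun=> c).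
Proof. by split; [exact: measurable_cst|exists `|c|]. Qed.

Lemma bounded_measurableD f g : bounded_measurable f -> bounded_measurable g ->
  bounded_measurable (fun x => f x + g x).
Proof.
move=> [mf [M hM]] [mg [N hN]]; split.
  exact: measurable_realfun.measurable_funD.
by exists (M + N) => x; rewrite (le_trans (ler_normD _ _))// lerD.
Qed.

Lemma bounded_measurableZ c f : bounded_measurable f ->
  bounded_measurable (fun x => c * f x).
Proof.
move=> [mf [M hM]]; split; first exact: measurable_realfun.measurable_funM.
by exists (`|c| * M) => x; rewrite normrM ler_wpM2l.
Qed.

Lemma bounded_measurableB f g : bounded_measurable f -> bounded_measurable g ->
  bounded_measurable (fun x => f x - g x).
Proof.
move=> bf bg; have := bounded_measurableD bf (bounded_measurableZ (-1) bg).
by congr (bounded_measurable _); apply/funext => x; rewrite mulN1r.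
Qed.

Lemma bounded_measurable_sum I (s : seq I) (F : I -> T -> R) :
  (forall i, bounded_measurable (F i)) ->
  bounded_measurable (fun x => \sum_(i <- s) F i x).
Proof.
move=> bF; elim: s => [|i s ih].
  by under eq_fun do rewrite big_nil; exact: bounded_measurable_cst.
by under eq_fun do rewrite big_cons; exact: bounded_measurableD.
Qed.

Lemma bounded_measurable_integrable (m : {finite_measure set T -> \bar R}) f :
  bounded_measurable f -> m.-integrable setT (EFin \o f).
Proof.
move=> [mf [M hM]]; apply: measurable_bounded_integrable => //.
  exact: fin_num_fun_lty.
by exists M; split; [exact: num_real|move=> N MN x _; exact: le_trans (ltW MN)].
Qed.

Lemma Rintegral_sum (m : {finite_measure set T -> \bar R}) I (s : seq I)
    (F : I -> T -> R) : (forall i, bounded_measurable (F i)) ->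
  \int[m]_x (\sum_(i <- s) F i x) = \sum_(i <- s) \int[m]_x F i x.
Proof.
move=> bF; elim: s => [|i s ih].
  under eq_Rintegral do rewrite big_nil.
  by rewrite big_nil Rintegral_cst// mul0r.
under eq_Rintegral do rewrite big_cons.
rewrite big_cons RintegralD ?ih//; apply: bounded_measurable_integrable => //.
exact: bounded_measurable_sum.
Qed.

Lemma charge_integralD nu f g : bounded_measurable f -> bounded_measurable g ->
  charge_integral nu (fun x => f x + g x)
  = charge_integral nu f + charge_integral nu g.
Proof.
move=> bf bg; rewrite /charge_integral !RintegralD//;
  try exact: bounded_measurable_integrable.
by rewrite opprD addrACA.
Qed.

Lemma charge_integralZ nu c f : bounded_measurable f ->
  charge_integral nu (fun x => c * f x) = c * charge_integral nu f.
Proof.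
move=> bf; rewrite /charge_integral !RintegralZl//;
  try exact: bounded_measurable_integrable.
by rewrite mulrBr.
Qed.

Lemma charge_integralB nu f g : bounded_measurable f -> bounded_measurable g ->
  charge_integral nu (fun x => f x - g x)
  = charge_integral nu f - charge_integral nu g.
Proof.
move=> bf bg; rewrite -[in RHS]mulN1r -charge_integralZ// -charge_integralD//.
  by congr charge_integral; apply/funext => x; rewrite mulN1r.
exact: bounded_measurableZ.
Qed.

Definition cbounded_measurable (f : T -> R[i]) :=
  bounded_measurable (fun x => complex.Re (f x)) /\
  bounded_measurable (fun x => complex.Im (f x)).

Lemma cbounded_measurableD (f g : T -> R[i]) :
  cbounded_measurable f -> cbounded_measurable g ->
  cbounded_measurable (fun x => f x + g x).
Proof.
move=> [bf1 bf2] [bg1 bg2]; split.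
  have := bounded_measurableD bf1 bg1.
  by congr (bounded_measurable _); apply/funext => x; case: (f x) (g x) => ? ? [].
have := bounded_measurableD bf2 bg2.
by congr (bounded_measurable _); apply/funext => x; case: (f x) (g x) => ? ? [].
Qed.

Lemma cbounded_measurableZ c (f : T -> R[i]) :
  cbounded_measurable f -> cbounded_measurable (fun x => c * f x).
Proof.
case: c => a b [bf1 bf2]; split.
  have := bounded_measurableB (bounded_measurableZ a bf1) (bounded_measurableZ b bf2).
  by congr (bounded_measurable _); apply/funext => x; case: (f x).
have := bounded_measurableD (bounded_measurableZ a bf2) (bounded_measurableZ b bf1).
by congr (bounded_measurable _); apply/funext => x; case: (f x).
Qed.

Lemma cbounded_measurable_sum I (s : seq I) (F : I -> T -> R[i]) :
  (forall i, cbounded_measurable (F i)) ->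
  cbounded_measurable (fun x => \sum_(i <- s) F i x).
Proof.
move=> bF; elim: s => [|i s ih].
  under eq_fun do rewrite big_nil.
  by split; exact: bounded_measurable_cst.
by under eq_fun do rewrite big_cons; exact: cbounded_measurableD.
Qed.

Variable mu : complex_measure T R.

Lemma complex_integralD (f g : T -> R[i]) :
  cbounded_measurable f -> cbounded_measurable g ->
  complex_integral mu (fun x => f x + g x)
  = complex_integral mu f + complex_integral mu g.
Proof.
move=> [bf1 bf2] [bg1 bg2]; rewrite /complex_integral.
have -> : (fun x => complex.Re (f x + g x))
    = (fun x => complex.Re (f x) + complex.Re (g x)).
  by apply/funext => x; case: (f x) (g x) => ? ? [].
have -> : (fun x => complex.Im (f x + g x))
    = (fun x => complex.Im (f x) + complex.Im (g x)).
  by apply/funext => x; case: (f x) (g x) => ? ? [].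
rewrite !charge_integralD//; apply/eqP; rewrite eq_complex/=.
by apply/andP; split; apply/eqP; ring.
Qed.

Lemma complex_integralZ c (f : T -> R[i]) : cbounded_measurable f ->
  complex_integral mu (fun x => c * f x) = c * complex_integral mu f.
Proof.
case: c => a b [bf1 bf2]; rewrite /complex_integral.
have -> : (fun x => complex.Re (Complex a b * f x))
    = (fun x => a * complex.Re (f x) - b * complex.Im (f x)).
  by apply/funext => x; case: (f x).
have -> : (fun x => complex.Im (Complex a b * f x))
    = (fun x => a * complex.Im (f x) + b * complex.Re (f x)).
  by apply/funext => x; case: (f x).
rewrite !charge_integralB ?charge_integralD ?charge_integralZ//;
  try exact: bounded_measurableZ.
by apply/eqP; rewrite eq_complex/=; apply/andP; split; apply/eqP; ring.
Qed.

Lemma complex_integral_sum I (s : seq I) (F : I -> T -> R[i]) :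
  (forall i, cbounded_measurable (F i)) ->
  complex_integral mu (fun x => \sum_(i <- s) F i x)
  = \sum_(i <- s) complex_integral mu (F i).
Proof.
move=> bF; elim: s => [|i s ih].
  under eq_fun do rewrite big_nil.
  rewrite big_nil /complex_integral /charge_integral/= !Rintegral_cst//.
  by rewrite !mul0r !subr0 addr0.
under eq_fun do rewrite big_cons.
by rewrite big_cons complex_integralD ?ih//; exact: cbounded_measurable_sum.
Qed.

(** Up to sign, the Jordan parts take on [N] the values of [nu] on the intersections of [N] with the
    two Hahn sets. These are measurable subsets of [N], so [N] is null for both parts and [f]
    vanishes almost everywhere. *)
Lemma charge_integral_null nu (N : set T) f : measurable_fun setT f ->
  measurable N -> (forall A, measurable A -> A `<=` N -> nu A = 0%E) ->
  (forall x, ~ N x -> f x = 0) -> charge_integral nu f = 0.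
Proof.
move=> mf mN nuN f0.
suff int0 (m : {measure set T -> \bar R}) : m N = 0%E -> \int[m]_x f x = 0.
  have [[mP _] [mQ _] _ _] := hahn_setsP nu.
  rewrite /charge_integral int0; last first.
    apply: etrans (jordan_posE _ _) _.
    rewrite cjordan_posE /crestr0 mem_set//= /crestr.
    by rewrite nuN//; exact: measurableI.
  rewrite int0 ?subrr//; apply: etrans (jordan_negE _ _) _.
  rewrite cjordan_negE /crestr0 mem_set//= /crestr.
  by rewrite nuN ?oppe0//; exact: measurableI.
move=> mN0; rewrite /Rintegral (@ae_eq_integral _ _ _ m setT (cst 0%E))//.
- by rewrite integral0.
- exact/measurable_realfun.measurable_EFinP.
- exists N; split => // x /= /not_implyP[_] fx; apply: contrapT => /f0 fx0.
  by apply: fx; rewrite /= fx0.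
Qed.

Lemma complex_integral_null (N : set T) (f : T -> R[i]) :
  cbounded_measurable f ->
  measurable N -> (forall A, measurable A -> A `<=` N -> cmeasure mu A = 0) ->
  (forall x, ~ N x -> f x = 0) -> complex_integral mu f = 0.
Proof.
move=> [[mf1 _] [mf2 _]] mN muN f0.
have Re0 A : measurable A -> A `<=` N -> Re_measure mu A = 0%E.
  move=> mA AN; have [h _] := muN _ mA AN.
  by rewrite -[Re_measure mu A]fineK ?fin_num_measure// h.
have Im0 A : measurable A -> A `<=` N -> Im_measure mu A = 0%E.
  move=> mA AN; have [_ h] := muN _ mA AN.
  by rewrite -[Im_measure mu A]fineK ?fin_num_measure// h.
rewrite /complex_integral !(@charge_integral_null _ N)// ?subrr ?addr0//.
all: by move=> x /f0 ->.
Qed.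

End bounded_measurable.

(** * Measurability on the torus, and nullity of a complex measure off its support *)

Section torus_measurability.
Variables (R : realType) (d : nat).
Implicit Types (y : circle R) (x : torus R d) (k : 'I_d -> int).

Lemma circle_projK (t : R) : 0 <= t < 1 -> val (circle_proj t) = t.
Proof.
move=> t01; rewrite /= (_ : Num.floor t = 0) ?subr0//.
by apply: floor_def; rewrite add0r.
Qed.

Lemma circle_valK : cancel (fun y => val y) (@circle_proj R).
Proof. by move=> y; apply/val_inj; rewrite circle_projK//; exact: (valP y). Qed.

(** As [a] is nonnegative, the integer [m] can only be the floor of [t]. The preimage of a
    superlevel set under the projection is therefore a union of open intervals. *)
Lemma circle_proj_gt (a t : R) : 0 <= a ->
  a < val (circle_proj t) <-> exists m : int, m%:~R + a < t < m%:~R + 1.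
Proof.
move=> a0 /=; have /andP[h1 h2] := floor_itv t; rewrite intrD in h2.
split=> [at_|[m /andP[mt tm]]].
  by exists (Num.floor t); apply/andP; split => //; lra.
suff -> : Num.floor t = m by lra.
by apply: floor_def; rewrite intrD; apply/andP; split => //; lra.
Qed.

(* val is not continuous at 0, but its superlevel sets are open. *)
Lemma measurable_circle_val : measurable_fun setT (fun y => val y : R).
Proof.
apply: (measurability _ (measurable_realfun.RGenOInfty.measurableE R)) => //.
move=> _ [_ [a ->] <-]; rewrite setTI.
have [a0|a0] := leP 0 a; last first.
  rewrite (_ : _ @^-1` _ = setT)//; apply/seteqP; split => // y _ /=.
  by rewrite in_itv/= andbT (lt_le_trans a0)//; have /andP[] := valP y.
apply: sub_sigma_algebra; rewrite /= /open/= /circle_open.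
rewrite (_ : _ @^-1` _ = \bigcup_(m : int) `]m%:~R + a, m%:~R + 1[%classic).
  by apply: bigcup_open => m _; exact: interval_open.
apply/seteqP; split => t /=; rewrite in_itv/= andbT.
  by move/(circle_proj_gt _ a0) => [m mt]; exists m => //=; rewrite in_itv.
by move=> [m _]; rewrite /= in_itv/= => mt; apply/(circle_proj_gt _ a0); exists m.
Qed.

Lemma measurable_torus_val (i : 'I_d) :
  measurable_fun setT (fun x => val (tnth x i) : R).
Proof.
by apply: (measurableT_comp measurable_circle_val); exact: measurable_tnth.
Qed.

Lemma measurable_dotk k : measurable_fun setT (@dotk R d k).
Proof.
rewrite /dotk; apply: (@measurable_sum _ _ R) => i.
by apply: measurable_realfun.measurable_funM => //; exact: measurable_torus_val.
Qed.

(** The phase [c] lets the cosine cover the sine too, hence the real and imaginary parts of all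
    characters. *)
Lemma bounded_measurable_cos_dotk k c :
  bounded_measurable (fun x => cos (2 * pi * dotk k x + c)).
Proof.
split; last by exists 1 => x; exact: cos_max.
apply: (@measurableT_comp _ _ _ _ _ _ (@cos R)).
  by apply: measurable_realfun.continuous_measurable_fun; exact: continuous_cos.
apply: measurable_realfun.measurable_funD => //.
by apply: measurable_realfun.measurable_funM => //; exact: measurable_dotk.
Qed.

Lemma cbounded_measurable_character k : cbounded_measurable (@character R d k).
Proof.
split => /=.
  by under eq_fun do rewrite -[X in cos X]addr0; exact: bounded_measurable_cos_dotk.
under eq_fun do rewrite -cosBpihalf.
exact: bounded_measurable_cos_dotk.
Qed.

(** Points with close representatives in [0,1) are close on the circle, because the projection is
    continuous. The converse fails at 0, which is also close to the points near 1. *)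
Lemma nbhs_circle y (A : set (circle R)) : nbhs y A ->
  exists2 e : R, 0 < e & forall z : circle R, `|val y - val z| < e -> A z.
Proof.
rewrite nbhsE => -[B [oB By] BA].
have : nbhs (val y : R) (@circle_proj R @^-1` B).
  by apply: open_nbhs_nbhs; split => //=; rewrite circle_valK.
move=> /nbhs_ballP[e /= e0 eB]; exists e => // z yz; apply: BA.
by rewrite -[z]circle_valK; apply: eB.
Qed.

Lemma nbhs_torus x (A : set (torus R d)) : nbhs x A ->
  exists2 e : R, 0 < e &
    forall z : torus R d, (forall i, `|val (tnth x i) - val (tnth z i)| < e) -> A z.
Proof.
move=> [U xU UA].
have /choice[e he] : forall i, exists e : R, 0 < e /\
    forall z : circle R, `|val (tnth x i) - val z| < e -> U i z.
  by move=> i; have [e e0 eU] := nbhs_circle (xU i); exists e.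
(* The default value 1 keeps the radius positive when [d] is 0. *)
exists (\big[Order.min/1]_i e i).
  by rewrite lt_bigmin// => i _; have [] := he i.
move=> z xz; apply: UA => i; have [_] := he i; apply.
by apply: lt_le_trans (xz i) _; exact: bigmin_le_cond.
Qed.

(** A countable substitute for a base of the topology. A box is measured on representatives, so it
    need not be open where a coordinate is 0; what matters is that it is measurable and that every
    neighbourhood of a point contains a box around that point. *)
Definition rat_box (qm : {ffun 'I_d -> rat} * nat) : set (torus R d) :=
  [set z | forall i, `|val (tnth z i) - ratr (qm.1 i)| < qm.2.+1%:R^-1].

Lemma measurable_rat_box qm : measurable (rat_box qm).
Proof.
rewrite (_ : rat_box qm = \bigcap_(i in [set: 'I_d])
    (fun z : torus R d => `|val (tnth z i) - ratr (qm.1 i)|)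
      @^-1` `]-oo, qm.2.+1%:R^-1[).
  apply: fin_bigcap_measurable => // i _; rewrite -[X in measurable X]setTI.
  suff : measurable_fun setT
      (fun z : torus R d => `|val (tnth z i) - ratr (qm.1 i)|) by apply.
  apply: measurableT_comp => //; apply: measurable_realfun.measurable_funB => //.
  exact: measurable_torus_val.
apply/seteqP; split => z /= hz i; first by rewrite /= in_itv/= hz.
by have := hz i Logic.I; rewrite /= in_itv.
Qed.

Lemma nbhs_rat_box x (A : set (torus R d)) : nbhs x A ->
  exists2 qm, rat_box qm x & rat_box qm `<=` A.
Proof.
move=> /nbhs_torus[e e0 eA].
(* Two points of a box are compared through its rational centre, which costs two radii; hence a
   radius below e / 2. *)
pose m := Num.truncn (2 / e).
have me : m.+1%:R^-1 < e / 2.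
  by rewrite -[e / 2]invrK ltf_pV2 ?posrE ?invr_gt0 ?divr_gt0// invf_div truncnS_gt.
have m0 : 0 < m.+1%:R^-1 :> R by [].
have /choice[q hq] : forall i, exists q : rat, `|val (tnth x i) - ratr q| < m.+1%:R^-1.
  move=> i; have [q] : exists q : rat,
      ratr q \in `](val (tnth x i) - m.+1%:R^-1), (val (tnth x i) + m.+1%:R^-1)[.
    by apply: rat_in_itvoo; rewrite ltrBlDr -addrA ltrDl addr_gt0.
  by rewrite in_itv/= => qi; exists q; rewrite distrC ltr_distl; exact: qi.
exists ([ffun i => q i], m) => [i|z hz]; first by rewrite /= ffunE; exact: hq.
apply: eA => i; have := hz i; rewrite /= ffunE distrC => zi.
rewrite (le_lt_trans (ler_distD (ratr (q i)) _ _))// [e]splitr.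
by apply: ltrD; [exact: lt_trans (hq i) me|exact: lt_trans zi me].
Qed.

(** The set [A] is cut into disjoint measurable pieces, each inside one [F n], and countable
    additivity gives a sum of zeros. *)
Lemma charge_bigcup_null (nu : {charge set (torus R d) -> \bar R})
    (F : (set (torus R d))^nat) : (forall n, measurable (F n)) ->
  (forall n A, measurable A -> A `<=` F n -> nu A = 0%E) ->
  forall A, measurable A -> A `<=` \bigcup_n F n -> nu A = 0%E.
Proof.
move=> mF F0 A mA AF.
have mG n : measurable (seqDU (fun n => A `&` F n) n).
  apply: measurableD; first exact: measurableI.
  by apply: bigsetU_measurable => i _; exact: measurableI.
have AE : A = \bigcup_n seqDU (fun n => A `&` F n) n.
  by rewrite -seqDU_bigcup_eq -setI_bigcupr; apply/esym/setIidPl.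
have := @charge_semi_sigma_additive _ _ _ nu _ mG (@trivIset_seqDU _ _).
rewrite -AE => /(_ mA) /cvg_lim <-//.
rewrite (_ : (fun n => _) = cst 0%E) ?lim_cst//.
apply/funext => n /=; rewrite big1// => i _; apply: (F0 i) => //.
by move=> z [[]].
Qed.

(** A Lindelof argument: [N] is the union of the countably many null boxes, and a point off the
    support has a null neighbourhood, hence lies in a null box. Since boxes need not be open, [N]
    may exceed the complement of the support. *)
Lemma msupport_null (mu : complex_measure (torus R d) R) :
  exists2 N, measurable N /\ ~` msupport mu `<=` N &
    forall A, measurable A -> A `<=` N -> cmeasure mu A = 0.
Proof.
pose null (B : set (torus R d)) :=
  forall A, measurable A -> A `<=` B -> cmeasure mu A = 0.
pose F (n : nat) := if unpickle n is Some qm then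
  (if `[< null (rat_box qm) >] then rat_box qm else set0) else set0.
have mF n : measurable (F n).
  rewrite /F; case: unpickle => // qm; case: ifP => // _.
  exact: measurable_rat_box.
have nF n A : measurable A -> A `<=` F n -> cmeasure mu A = 0.
  have n0 : A `<=` set0 -> cmeasure mu A = 0.
    by rewrite subset0 => ->; rewrite /cmeasure !charge0.
  rewrite /F; case: unpickle => // qm; case: ifP => // /asboolP h; exact: h.
have Re0 n A : measurable A -> A `<=` F n -> Re_measure mu A = 0%E.
  move=> mA AN; have [h _] := nF _ _ mA AN.
  by rewrite -[Re_measure mu A]fineK ?fin_num_measure// h.
have Im0 n A : measurable A -> A `<=` F n -> Im_measure mu A = 0%E.
  move=> mA AN; have [_ h] := nF _ _ mA AN.
  by rewrite -[Im_measure mu A]fineK ?fin_num_measure// h.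
exists (\bigcup_n F n).
  split; first exact: bigcupT_measurable.
  move=> x /= /existsNP[A /not_implyP[xA nA]].
  have [qm xqm qmA] := nbhs_rat_box xA.
  exists (pickle qm) => //; rewrite /F pickleK ifT//; apply/asboolP => B mB Bqm.
  apply: contrapT => B0; apply: nA; exists B; split => //.
    exact: subset_trans Bqm qmA.
  exact/eqP.
move=> A mA AF; rewrite /cmeasure.
by rewrite (charge_bigcup_null mF Re0)// (charge_bigcup_null mF Im0).
Qed.

Lemma complex_integral_msupport (mu : complex_measure (torus R d) R)
    (f : torus R d -> R[i]) : cbounded_measurable f ->
  (forall x, msupport mu x -> f x = 0) -> complex_integral mu f = 0.
Proof.
move=> bf f0; have [N [mN suppN] N0] := msupport_null mu.
apply: (complex_integral_null bf mN N0) => x Nx; apply: f0.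
by apply: contrapT => /suppN.
Qed.

End torus_measurability.

(** * Integrals of characters over the circle and the torus *)

Section fourier_orthogonality.
Variable R : realType.

Lemma periodicz (f : R -> R) (T : R) : periodic f T ->
  forall (m : int) a, f (a + T *~ m) = f a.
Proof.
move=> fT [m|m] a; first exact: (periodicn fT).
by rewrite -[in RHS](addrNK (T *+ m.+1) a) (periodicn fT).
Qed.

(** For an integer frequency, removing the floor of [t] shifts the argument by a multiple of the
    period. Integrals over the circle thereby become integrals of a smooth function over [0,1]. *)
Lemma cos_dot_circle_proj (m : int) (c t : R) :
  cos (2 * pi * (m%:~R * val (circle_proj t)) + c)
  = cos (2 * pi * (m%:~R * t) + c).
Proof.
rewrite /= -[RHS](periodicz (@cosD2pi R) (- (m * Num.floor t))).
congr cos; rewrite mulrNz -(mulrzr (pi *+ 2)) intrM -mulr_natl; ring.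
Qed.

Lemma integral_cos_circle (m : int) (c : R) :
  (\int[lebesgue_circle R]_y (cos (2 * pi * (m%:~R * val y) + c))%:E
   = ((m == 0)%:R * cos c)%:E)%E.
Proof.
have cosc : continuous (fun t : R => cos (2 * pi * (m%:~R * t) + c)).
  move=> t.
  apply: (@continuous_comp _ _ _ (fun t : R => 2 * pi * (m%:~R * t) + c)).
    apply: cvgD; last exact: cvg_cst.
    apply: cvgM; first exact: cvg_cst.
    by apply: cvgM; [exact: cvg_cst|exact: cvg_id].
  exact: continuous_cos.
have bf : bounded_measurable (fun t : R => cos (2 * pi * (m%:~R * t) + c)).
  split; last by exists 1 => t; exact: cos_max.
  exact: measurable_realfun.continuous_measurable_fun.
pose P := [the probability (measurableTypeR R) R of uniform_prob (@ltr01 R)].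
transitivity (\int[P]_t (cos (2 * pi * (m%:~R * t) + c))%:E)%E.
  rewrite /lebesgue_circle/= integral_distribution; last 2 first.
  - apply/measurable_realfun.measurable_EFinP; apply: measurableT_comp.
      by apply: measurable_realfun.continuous_measurable_fun; exact: continuous_cos.
    apply: measurable_realfun.measurable_funD => //.
    apply: measurable_realfun.measurable_funM => //.
    by apply: measurable_realfun.measurable_funM => //; exact: measurable_circle_val.
  - have := bounded_measurable_integrable P bf; congr integrable.
    by apply/funext => t /=; rewrite cos_dot_circle_proj.
  by apply: eq_integral => t _; rewrite /= cos_dot_circle_proj.
have intP : P.-integrable setT (EFin \o (fun t => cos (2 * pi * (m%:~R * t) + c))).
  exact: bounded_measurable_integrable.
have P1 : (\int[P]_t (1 : R)%:E = 1)%E.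
  by rewrite integral_cst// mul1e; exact: (@probability_setT _ _ _ P).
(* The formula [integral_uniform] asks for a nonnegative integrand, so 1 is added to the cosine; the
   finite integrals allow it to be cancelled. *)
suff : (1 + \int[P]_t (cos (2 * pi * (m%:~R * t) + c))%:E
        = (1 + (m == 0)%:R * cos c)%:E)%E.
  have := integrable_fin_num measurableT intP.
  by rewrite /comp/= => /fineK <-; rewrite -EFinD => -[/addrI ->].
rewrite -{1}P1 -(@integralD_EFin _ _ _ P)//; last first.
  by apply: bounded_measurable_integrable; exact: bounded_measurable_cst.
rewrite integral_uniform; last 2 first.
- apply/measurable_realfun.measurable_EFinP.
  by apply: measurable_realfun.measurable_funD => //; exact: bf.1.
- by move=> t; rewrite lee_fin; have := cos_geN1 (2 * pi * (m%:~R * t) + c) => /=; lra.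
rewrite subr0 invr1 mul1e.
have [->|m0] := eqVneq m 0.
  under eq_integral do rewrite /= mul0r mulr0 add0r.
  rewrite integral_cst//= lebesgue_measure_itv/= lte01 sube0 mule1.
  by rewrite mul1r.
have w0 : 2 * pi * m%:~R != 0 :> R.
  by rewrite mulf_neq0 ?intr_eq0// mulf_neq0// gt_eqF// pi_gt0.
(* A primitive of the shifted integrand. Its sine term is 1-periodic, so only the added 1
   contributes to F 1 - F 0. *)
pose F (t : R) := t + (2 * pi * m%:~R)^-1 * sin (2 * pi * (m%:~R * t) + c).
have dF (t : R) : is_derive t 1 F (1 + cos (2 * pi * (m%:~R * t) + c)).
  rewrite /F; apply: is_derive_eq. 
  by rewrite addr0 /GRing.scale/= mulr1 mulrCA mulVf// mulr1.
rewrite (@continuous_FTC2 _ _ F)//.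
- rewrite /F mulr1 mulr0 mulr0 add0r -EFinB mul0r addr0.
  rewrite -[2 * pi * m%:~R + c]addrC mulr_natl mulrzr.
  rewrite (periodicz (@sinD2pi R)); by rewrite add0r addrK.
- apply: continuous_subspaceT => t.
  by apply: cvgD; [exact: cvg_cst|exact: cosc].
- split => [t _||].
  + by have [] := dF t.
  + apply: cvg_at_right_filter. apply: differentiable_continuous.
    by apply/derivable1_diffP; have [] := dF 0.
  + apply: cvg_at_left_filter. apply: differentiable_continuous.
    by apply/derivable1_diffP; have [] := dF 1.
- by move=> t _; rewrite derive1E; exact: derive_val.
Qed.

Lemma dotk_cons d (k : 'I_d.+1 -> int) (z : circle R * d.-tuple (circle R)) :
  dotk k (cons_pair z : torus R d.+1)
  = (k ord0)%:~R * val z.1 + dotk (fun i => k (lift ord0 i)) (z.2 : torus R d).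
Proof.
rewrite /dotk big_ord_recl; congr (_ * val _ + _).
by apply: eq_bigr => i _; congr (_ * val _); rewrite !(tnth_nth z.1).
Qed.

(** Induction on [d] by Fubini. The phase [c] is kept general because, for the inner integral over
    the last coordinates, the first coordinate is absorbed into the phase. *)
Lemma integral_cos_torus d (k : 'I_d -> int) (c : R) :
  (\int[lebesgue_torus R d]_x (cos (2 * pi * dotk k x + c))%:E
   = ([forall i, k i == 0]%:R * cos c)%:E)%E.
Proof.
elim: d k c => [|d ih] k c.
  rewrite (_ : [forall i, k i == 0] = true); last by apply/forallP => -[].
  under eq_integral do rewrite /dotk big_ord0 mulr0 add0r.
  rewrite integral_cst// mul1r.
  apply: etrans (congr1 (mule _) (@probability_setT _ _ _ (lebesgue_torus R 0))) _.
  by rewrite mule1.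
have mf := (bounded_measurable_cos_dotk (R := R) k c).1.
have bf : bounded_measurable
    (fun z : circle R * torus R d => cos (2 * pi * dotk k (cons_pair z) + c)).
  split; last by exists 1 => x; exact: cos_max.
  exact: (measurableT_comp mf (@measurable_funPT _ _ _ _ (@cons_pair _ (circle R) d))).
have if_ := bounded_measurable_integrable
  [the probability _ _ of (lebesgue_circle R \x prob_power (lebesgue_circle R) d)%E] bf.
rewrite /lebesgue_torus/= integral_distribution//; last 1 first.
- exact/measurable_realfun.measurable_EFinP.
rewrite -integral12_prod_meas1//.
transitivity (\int[lebesgue_circle R]_y
    ([forall i, k (lift ord0 i) == 0]%:R
     * cos (2 * pi * ((k ord0)%:~R * val y) + c))%:E)%E.
  apply: eq_integral => y _; rewrite /fubini_F/= -ih.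
  apply: eq_integral => x _; congr (cos _)%:E.
  by rewrite dotk_cons mulrDr addrAC addrC.
have -> : [forall i, k i == 0] = (k ord0 == 0) && [forall i, k (lift ord0 i) == 0].
  apply/forallP/andP => [k0|[k0 /forallP k1] i].
    by split; [exact: k0|apply/forallP => i; exact: k0].
  by case: (unliftP ord0 i) => [j ->|->].
case: [forall i, k (lift ord0 i) == 0].
  rewrite andbT -integral_cos_circle.
  by apply: eq_integral => y _; rewrite mul1r.
rewrite andbF mul0r; under eq_integral do rewrite mul0r.
exact: integral0.
Qed.
End fourier_orthogonality.

(** * Characters and Parseval's identity *)

Section trigonometric_polynomials.
Variables (R : realType) (d n : nat).
Local Notation N := (Nfreq d n).
Implicit Types (k l : 'I_d -> int) (x : torus R d) (p : 'cV[R[i]]_N).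

Lemma conjCE (z : R[i]) : z^* = Complex (complex.Re z) (- complex.Im z).
Proof. by case: z. Qed.

Lemma normcE (z : R[i]) : Normc.normc z ^+ 2 = complex.Re z ^+ 2 + complex.Im z ^+ 2.
Proof. by case: z => a b /=; rewrite sqr_sqrtr// addr_ge0// sqr_ge0. Qed.

Lemma normcJ (z : R[i]) : (Normc.normc z ^+ 2)%:C%C = z * z^*.
Proof.
rewrite normcE; case: z => a b; apply/eqP; rewrite eq_complex/=.
by apply/andP; split; apply/eqP; ring.
Qed.

Lemma dotkD k l x : dotk (fun i => k i + l i) x = dotk k x + dotk l x.
Proof. by rewrite /dotk -big_split; apply: eq_bigr => i _; rewrite intrD mulrDl. Qed.

Lemma dotkN k x : dotk (fun i => - k i) x = - dotk k x.
Proof. by rewrite /dotk -sumrN; apply: eq_bigr => i _; rewrite mulrNz mulNr. Qed.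

Lemma characterD k l x :
  character (fun i => k i + l i) x = character k x * character l x.
Proof.
rewrite /character dotkD mulrDr cosD sinD; congr Complex.
by rewrite addrC [X in X + _]mulrC.
Qed.

Lemma characterN k x : character (fun i => - k i) x = (character k x)^*.
Proof. by rewrite /character dotkN mulrN cosN sinN. Qed.

Lemma normc_character k x : Normc.normc (character k x) ^+ 2 = 1.
Proof. by rewrite normcE/= cos2Dsin2. Qed.

(** Both terms are cosines with a phase, the trivial phase 0 included, so that [integral_cos_torus]
    applies to each. *)
Lemma Re_mul_character (a : R[i]) k x : complex.Re (a * character k x)
  = complex.Re a * cos (2 * pi * dotk k x + 0)
    + complex.Im a * cos (2 * pi * dotk k x + pi / 2).
Proof. by case: a => a b /=; rewrite addr0 cosDpihalf mulrN. Qed.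

Lemma freq_inj (k l : 'I_N) : freq k =1 freq l -> k = l.
Proof.
move=> kl; apply: (@cast_ord_inj _ _ (esym (card_freq d n))); apply: enum_val_inj.
by apply/ffunP => i; apply: val_inj; have [] := kl i.
Qed.

Lemma normc_poly_of p x : Normc.normc (poly_of p x) ^+ 2 = \sum_k \sum_l
  complex.Re (p k 0 * (p l 0)^* * character (fun i => freq k i - freq l i) x).
Proof.
have ReS (I : finType) (F : I -> R[i]) :
    complex.Re (\sum_i F i) = \sum_i complex.Re (F i).
  by apply: (big_morph (@complex.Re R)) => // -[? ?] [].
rewrite -[LHS]/(complex.Re (_%:C%C)) normcJ /poly_of rmorph_sum mulr_suml ReS.
apply: eq_bigr => k _; rewrite mulr_sumr ReS; apply: eq_bigr => l _.
by rewrite rmorphM characterD characterN mulrACA.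
Qed.

(** In the double sum for the squared modulus, a term with distinct indices has a nonzero frequency
    by [freq_inj] and integrates to 0; a diagonal term is constant. *)
Lemma normL2E p : normL2 p ^+ 2 = \sum_k Normc.normc (p k 0) ^+ 2.
Proof.
have bc k c := bounded_measurable_cos_dotk (R := R) (d := d) k c.
have intc k c : \int[lebesgue_torus R d]_x cos (2 * pi * dotk k x + c)
    = [forall i, k i == 0]%:R * cos c by rewrite /Rintegral integral_cos_torus.
suff E : \int[lebesgue_torus R d]_x (Normc.normc (poly_of p x) ^+ 2)
    = \sum_k Normc.normc (p k 0) ^+ 2.
  by rewrite /normL2 E sqr_sqrtr// sumr_ge0// => k _; rewrite sqr_ge0.
under eq_Rintegral do rewrite normc_poly_of.
have bm (k l : 'I_N) : bounded_measurable (fun x => complex.Re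
    (p k 0 * (p l 0)^* * character (fun i => freq k i - freq l i) x)).
  under eq_fun do rewrite Re_mul_character.
  by apply: bounded_measurableD; apply: bounded_measurableZ.
rewrite Rintegral_sum; last by move=> k; exact: bounded_measurable_sum.
apply: eq_bigr => k _; rewrite Rintegral_sum// (bigD1 k)//= big1 => [|l lk].
  under eq_Rintegral do rewrite Re_mul_character.
  rewrite RintegralD//;
    try by apply: bounded_measurable_integrable; apply: bounded_measurableZ.
  rewrite !RintegralZl//; try exact: bounded_measurable_integrable.
  rewrite !intc cos0 cos_pihalf.
  rewrite (_ : [forall i, _] = true); last by apply/forallP => i; rewrite subrr.
  by rewrite !mulr1 !mulr0 !addr0 -[RHS]/(complex.Re (_%:C%C)) normcJ.
under eq_Rintegral do rewrite Re_mul_character.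
rewrite RintegralD//;
  try by apply: bounded_measurable_integrable; apply: bounded_measurableZ.
rewrite !RintegralZl//; try exact: bounded_measurable_integrable.
rewrite !intc (_ : [forall i, _] = false) ?mul0r ?mulr0 ?addr0//.
apply/negbTE; apply: contra lk => /forallP kl; apply/eqP/esym/freq_inj => i.
by apply/eqP; rewrite -subr_eq0.
Qed.

End trigonometric_polynomials.

(** * Unitary matrices, singular values and the Cauchy-Schwarz inequality *)

Section unitary_matrices.
Variables (R : realType) (N : nat).
Implicit Types (T U W : 'M[R[i]]_N) (sigma : 'rV[R]_N) (p c : 'cV[R[i]]_N).
Local Open Scope sesquilinear_scope.

Lemma trmxC_mul (a b e : nat) (A : 'M[R[i]]_(a, b)) (B : 'M[R[i]]_(b, e)) :
  (A *m B) ^t* = B ^t* *m A ^t*.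
Proof. by rewrite trmx_mul map_mxM. Qed.

Lemma trmxC_mulr (A : 'rV[R[i]]_N) :
  (A *m A ^t*) 0 0 = (\sum_j Normc.normc (A 0 j) ^+ 2)%:C%C.
Proof.
by rewrite mxE rmorph_sum; apply: eq_bigr => j _; rewrite !mxE -normcJ.
Qed.

Lemma unitarymx_normr U (A : 'rV[R[i]]_N) : U \is unitarymx ->
  \sum_j Normc.normc ((A *m U) 0 j) ^+ 2 = \sum_j Normc.normc (A 0 j) ^+ 2.
Proof.
move=> uU; apply: complexI; rewrite -!trmxC_mulr trmxC_mul mulmxA.
by rewrite -(mulmxA A) (unitarymxP uU) mulmx1.
Qed.

Lemma unitarymx_normc U c : U \is unitarymx ->
  \sum_j Normc.normc ((U *m c) j 0) ^+ 2 = \sum_j Normc.normc (c j 0) ^+ 2.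
Proof.
move=> uU; have := @unitarymx_normr U^T c^T; rewrite trmx_unitary => /(_ uU).
rewrite -trmx_mul; under eq_bigr do rewrite mxE.
by under [in RHS]eq_bigr do rewrite mxE.
Qed.

(** The singular values are nonnegative and nonincreasing, so the nonzero ones occupy an initial
    segment of indices, whose length is the rank because [U] and [W] are invertible. *)
Lemma svd_ltn_rank T U sigma W : is_svd T U sigma W ->
  forall j : 'I_N, (j < \rank T)%N = (sigma 0 j != 0).
Proof.
move=> [uU uW s0 sdec TE].
pose S := [set j : 'I_N | sigma 0 j != 0]%SET.
have cardlt (j : 'I_N) : #|[set i : 'I_N | (i < j)%N]%SET| = j.
  rewrite -sum1_card; under eq_bigl do rewrite inE.
  by rewrite (big_ord_narrow (ltnW (ltn_ord j))) sum1_card card_ord.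
have Slt (j : 'I_N) : (j < #|S|)%N = (sigma 0 j != 0).
  have [sj0|sj] := eqVneq (sigma 0 j) 0.
    apply/negbTE; rewrite -leqNgt -[X in (_ <= X)%N]cardlt subset_leq_card//.
    apply/fintype.subsetP => i; rewrite !inE ltnNge; apply: contra => ji.
    by rewrite eq_le s0 andbT -sj0 sdec.
  rewrite -[X in (X < _)%N]cardlt proper_card//; apply/fintype.properP; split.
    apply/fintype.subsetP => i; rewrite !inE => ij; apply: contra sj => /eqP si0.
    by rewrite eq_le s0 andbT -si0 sdec// ltnW.
  by exists j; rewrite inE ?ltnn.
suff -> : \rank T = #|S| by [].
rewrite TE mxrankMfree; last first.
  by rewrite row_free_unit; apply: unitarymx_unit; rewrite trmxC_unitary; exact: uW.
rewrite eqmxMfull; last by rewrite row_full_unit; exact: unitarymx_unit uU.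
(* Replacing the zero singular values by 1 gives an invertible diagonal factor; the remaining factor
   is a partial identity of known rank. *)
pose D : 'rV[R[i]]_N := \row_j (if sigma 0 j == 0 then 1 else (sigma 0 j)%:C%C).
rewrite (_ : diag_mx _ = diag_mx D *m pid_mx #|S|).
  rewrite eqmxMfull ?rank_pid_mx//.
  - by rewrite -[X in (_ <= X)%N]card_ord max_card.
  - by rewrite -[X in (_ <= X)%N]card_ord max_card.
  rewrite row_full_unit unitmxE det_diag unitfE; apply/prodf_neq0 => j _.
  rewrite mxE; case: ifPn => sj; first by rewrite oner_eq0.
  by rewrite eq_complex/= negb_and sj.
apply/matrixP => i j; rewrite mul_diag_mx !mxE Slt.
case: (eqVneq i j) => [<-|ij]; last first.
  by rewrite mulr0n (negbTE (_ : _ != _ :> nat))//= mulr0.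
by rewrite eqxx mulr1n/=; case: eqVneq => [->|_] /=; rewrite ?mulr0 ?mulr1.
Qed.

(** The adjoint of [T] is W Sigma U^* with real Sigma. As [W] is injective, only the coordinates of
    U^* p at nonzero singular values are constrained. *)
Lemma svd_ker_adjoint T U sigma W p : is_svd T U sigma W ->
  T ^t* *m p = 0 <-> forall j : 'I_N, (j < \rank T)%N -> (U ^t* *m p) j 0 = 0.
Proof.
move=> svdT; have rk := svd_ltn_rank svdT; move: svdT => [uU uW _ _ TE].
set c := U ^t* *m p; pose s : 'rV[R[i]]_N := map_mx (fun s : R => s%:C%C) sigma.
have -> : T ^t* *m p = W *m (diag_mx s *m c).
  rewrite TE !trmxC_mul trmxCK -!mulmxA; congr (_ *m (_ *m _)).
  apply/matrixP => i j; rewrite !mxE eq_sym; case: eqVneq => [->|_].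
    by rewrite !mulr1n conjCE/= oppr0.
  by rewrite !mulr0n conjC0.
have WD : W *m (diag_mx s *m c) = 0 <-> diag_mx s *m c = 0.
  split=> [/(congr1 (mulmx (W ^t*)))|->]; last by rewrite mulmx0.
  by rewrite (mulmxA (W ^t*)) (mulmx1C (unitarymxP uW)) mul1mx mulmx0.
split=> [/WD sc j|c0]; last apply/WD.
  rewrite rk => sj; have /matrixP/(_ j 0) := sc.
  rewrite mul_diag_mx !mxE => /eqP; rewrite mulf_eq0 => /orP[|/eqP//].
  by rewrite eq_complex/= (negbTE sj).
apply/matrixP => j k; rewrite ord1 mul_diag_mx !mxE.
have [sj|sj] := eqVneq (sigma 0 j) 0; first by rewrite sj mul0r.
by have := c0 j; rewrite rk => /(_ sj); rewrite mxE => ->; rewrite mulr0.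
Qed.

Lemma cauchy_schwarz_sum (P : pred 'I_N) (a b : 'I_N -> R[i]) :
  Normc.normc (\sum_(j | P j) a j * b j) ^+ 2 <=
  (\sum_(j | P j) Normc.normc (a j) ^+ 2) * (\sum_(j | P j) Normc.normc (b j) ^+ 2).
Proof.
(* Extension by zero restricts the sums to [P], and conjugating [b] cancels the conjugation in the
   Hermitian product. *)
pose u : 'rV[R[i]]_N := \row_j (if P j then a j else 0).
pose v : 'rV[R[i]]_N := \row_j (if P j then (b j)^* else 0).
have sumE (w : 'rV[R[i]]_N) (f : 'I_N -> R[i]) :
    (forall j, Normc.normc (w 0 j) = if P j then Normc.normc (f j) else 0) ->
    \sum_j Normc.normc (w 0 j) ^+ 2 = \sum_(j | P j) Normc.normc (f j) ^+ 2.
  move=> wf; rewrite [RHS]big_mkcond; apply: eq_bigr => j _.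
  by rewrite wf; case: ifP => // _; rewrite expr0n.
have : `|dotmx u v| ^+ 2 <= dotmx u u * dotmx v v.
  by have [] := CauchySchwarz (@dotmx _ N) u v.
rewrite !dotmxE !trmxC_mulr.
have -> : (u *m v ^t*) 0 0 = \sum_(j | P j) a j * b j.
  rewrite mxE [RHS]big_mkcond; apply: eq_bigr => j _; rewrite !mxE.
  by case: ifP => _; rewrite ?conjCK// mul0r.
rewrite (sumE u a); last by move=> j; rewrite mxE; case: ifP; rewrite ?Normc.normc0.
rewrite (sumE v b); last first.
  move=> j; rewrite mxE; case: ifP; rewrite ?Normc.normc0// => _.
  by rewrite conjCE; case: (b j) => ? ? /=; rewrite sqrrN.
by rewrite -rmorphM normCK -normcJ lecR.
Qed.

End unitary_matrices.

(** * The kernel of the moment matrix and the reflection of frequencies *)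

Section moment_matrix.
Variables (R : realType) (d n : nat).
Local Notation N := (Nfreq d n).
Implicit Types (mu : complex_measure (torus R d) R) (x : torus R d).
Implicit Types (p c : 'cV[R[i]]_N) (U : 'M[R[i]]_N).
Local Open Scope sesquilinear_scope.

Lemma moment_matrix_mulmxE mu p k : (moment_matrix n mu *m p) k 0
  = complex_integral mu (fun x => \sum_l
      p l 0 * character (fun i => - (freq k i - freq l i)) x).
Proof.
rewrite complex_integral_sum => [|l]; last first.
  by apply: cbounded_measurableZ; exact: cbounded_measurable_character.
rewrite mxE; apply: eq_bigr => l _; rewrite complex_integralZ ?mxE 1?mulrC//.
exact: cbounded_measurable_character.
Qed.

Lemma moment_matrix_ker mu p : (forall x, msupport mu x -> poly_of p x = 0) ->
  moment_matrix n mu *m p = 0.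
Proof.
move=> p0; apply/matrixP => k j; rewrite ord1 moment_matrix_mulmxE mxE.
apply: complex_integral_msupport => [|x /p0 px0].
  apply: cbounded_measurable_sum => l; apply: cbounded_measurableZ.
  exact: cbounded_measurable_character.
(* The integrand is the character of frequency -k times p(x), so it vanishes wherever p does. *)
rewrite -[RHS](mulr0 (character (fun i => - freq k i) x)) -[in RHS]px0 mulr_sumr.
apply: eq_bigr => l _; rewrite mulrCA -characterD; congr (_ * character _ x).
by apply/funext => i; rewrite opprB addrC.
Qed.

(* The index of the reflected frequency (n, ..., n) - freq j. *)
Definition flip (j : 'I_N) : 'I_N :=
  cast_ord (card_freq d n) (enum_rank [ffun i => rev_ord
    ((enum_val (cast_ord (esym (card_freq d n)) j) : {ffun 'I_d -> 'I_n.+1}) i)]).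

Lemma freq_flip j i : freq (flip j) i = n%:Z - freq j i.
Proof.
rewrite /freq /flip cast_ordK enum_rankK ffunE /= subzn ?subSS//.
by rewrite -ltnS.
Qed.

Lemma flipK : involutive flip.
Proof. by move=> j; apply: freq_inj => i; rewrite !freq_flip opprB addrC subrK. Qed.

(** The coefficients of the conjugate reciprocal polynomial. *)
Definition flipC p : 'cV[R[i]]_N := \col_k (p (flip k) 0)^*.

Lemma flipCK : involutive flipC.
Proof. by move=> p; apply/matrixP => k j; rewrite ord1 !mxE flipK conjCK. Qed.

Lemma poly_of_flipC p x :
  poly_of (flipC p) x = character (fun=> n%:Z) x * (poly_of p x)^*.
Proof.
rewrite rmorph_sum mulr_sumr /poly_of [RHS](reindex_inj (inv_inj flipK)).
apply: eq_bigr => k _; rewrite mxE rmorphM/= mulrCA -characterN -characterD.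
congr (_ * character _ x); apply/funext => i.
by rewrite freq_flip opprB addrC subrK.
Qed.

Lemma poly_of_flipC_eq0 p x : poly_of p x = 0 -> poly_of (flipC p) x = 0.
Proof. by rewrite poly_of_flipC => ->; rewrite rmorph0 mulr0. Qed.

Lemma moment_matrix_flip mu k l :
  moment_matrix n mu (flip k) (flip l) = moment_matrix n mu l k.
Proof.
rewrite !mxE; congr moment; apply/funext => i.
by rewrite !freq_flip; ring.
Qed.

(* A Toeplitz matrix is conjugated to its transpose by the reflection of the
   indices. *)
Lemma ker_moment_matrix_flipC mu p :
  moment_matrix n mu *m p = 0 <-> (moment_matrix n mu) ^t* *m flipC p = 0.
Proof.
have E k : ((moment_matrix n mu) ^t* *m flipC p) k 0
    = ((moment_matrix n mu *m p) (flip k) 0)^*.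
  rewrite !mxE rmorph_sum [RHS](reindex_inj (inv_inj flipK)).
  by apply: eq_bigr => l _; rewrite rmorphM moment_matrix_flip !mxE.
split=> [Tp0|Tp0]; apply/matrixP => k j; rewrite ord1.
  by rewrite E Tp0 !mxE rmorph0.
by rewrite -[k in LHS]flipK -[LHS]conjCK -E Tp0 !mxE rmorph0.
Qed.

Lemma poly_ofE p x : poly_of p x = ((evec n x) ^t* *m p) 0 0.
Proof.
rewrite mxE; apply: eq_bigr => k _.
by rewrite !mxE characterN conjCK mulrC.
Qed.

Lemma poly_of_mulmx U c x : poly_of (U *m c) x = \sum_j usv U j x * c j 0.
Proof. by rewrite poly_ofE mulmxA mxE. Qed.

(** The [Nfreq d n] entries of [evec n x] have modulus 1, and a unitary matrix preserves the
    norm. *)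
Lemma sum_normc_usv U x : U \is unitarymx ->
  \sum_j Normc.normc (usv U j x) ^+ 2 = N%:R.
Proof.
move=> uU; rewrite /usv unitarymx_normr//.
under eq_bigr do rewrite !mxE characterN conjCK normc_character.
by rewrite sumr_const card_ord.
Qed.

End moment_matrix.

(** * The values of [p0] and [p1] and the variational characterization *)

Theorem theorem3p1 (R : realType) (d n : nat)
    (mu : complex_measure (torus R d) R) (V : set (torus R d))
    (U W : 'M[R[i]]_(Nfreq d n)) (sigma : 'rV[R]_(Nfreq d n)) :
  (0 < d)%N -> (0 < n)%N ->
  cmeasure mu setT = 1 ->
  zariski_closure (msupport mu) V ->
  is_svd (moment_matrix n mu) U sigma W ->
  zeros_ker (moment_matrix n mu) = V ->
  [/\ forall x, p0 (moment_matrix n mu) U x + p1 (moment_matrix n mu) U x = 1,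
      forall x, V x -> p1 (moment_matrix n mu) U x = 1,
      forall x, ~ V x -> p1 (moment_matrix n mu) U x < 1 &
      V `<` setT -> forall x,
        is_max
          [set Normc.normc (poly_of p x) ^+ 2
                 / ((Nfreq d n)%:R * normL2 p ^+ 2)
            | p in [set p : 'cV[R[i]]_(Nfreq d n) |
                      p != 0 /\ forall y, V y -> poly_of p y = 0]]
          (p0 (moment_matrix n mu) U x)].
Proof.
move=> _ _ _ [suppV _ _] svdT zV; set T := moment_matrix n mu in svdT zV *.
have uU : U \is unitarymx by case: svdT.
have UU : (U ^t*)%sesqui *m U = 1%:M := mulmx1C (unitarymxP uU).
have UU' : U *m (U ^t*)%sesqui = 1%:M := unitarymxP uU.
have N0 : 0 < (Nfreq d n)%:R :> R by rewrite ltr0n expn_gt0.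
have sq0 (z : R[i]) : 0 <= Normc.normc z ^+ 2 by exact: sqr_ge0.
(* Vanishing on V amounts to being spanned by the columns U_j, j >= rank T. *)
have vanishP (p : 'cV[R[i]]_(Nfreq d n)) :
    (forall y, V y -> poly_of p y = 0) <->
    forall j : 'I_(Nfreq d n), (j < \rank T)%N -> ((U ^t*)%sesqui *m p) j 0 = 0.
  (* The columns of [U] describe the kernel of the adjoint, whereas the support and [zV] speak of
     the kernel of [T]; [flipC] passes between the two without changing zeros. *)
  rewrite -(svd_ker_adjoint _ svdT); split=> [pV|Tp y].
    rewrite -[p]flipCK -ker_moment_matrix_flipC; apply: moment_matrix_ker.
    by move=> y /suppV /pV; exact: poly_of_flipC_eq0.
  rewrite -zV => /(_ (flipC p)) yp; rewrite -[p]flipCK.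
  by apply/poly_of_flipC_eq0/yp/ker_moment_matrix_flipC; rewrite flipCK.
have vanish_mul (c : 'cV[R[i]]_(Nfreq d n)) :
    (forall j : 'I_(Nfreq d n), (j < \rank T)%N -> c j 0 = 0) ->
    forall y, V y -> poly_of (U *m c) y = 0.
  by move=> c0; apply/vanishP; rewrite mulmxA UU mul1mx.
have usv_V x (j : 'I_(Nfreq d n)) : V x -> (\rank T <= j)%N -> usv U j x = 0.
  (* The unit vector selects the column U_j, whose polynomial is [usv U j]. *)
  move=> Vx rj; have := vanish_mul (delta_mx j 0) _ x Vx.
  rewrite poly_of_mulmx (bigD1 j)//= big1 => [|k kj]; last first.
    by rewrite mxE (negbTE kj) mulr0.
  rewrite mxE !eqxx mulr1 addr0; apply => k kr; rewrite mxE.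
  by case: eqVneq kr => // ->; rewrite ltnNge rj.
have p01 x : p0 T U x + p1 T U x = 1.
  rewrite /p0 /p1 -mulrDr -[RHS](mulVf (lt0r_neq0 N0)).
  rewrite -[X in _ = _ * X](sum_normc_usv x uU).
  rewrite [in RHS](bigID (fun j : 'I__ => (\rank T <= j)%N))/=.
  by congr (_ * (_ + _)); apply: eq_bigl => j; rewrite -ltnNge.
have poly_tail (p : 'cV[R[i]]_(Nfreq d n)) x :
    (forall y, V y -> poly_of p y = 0) -> poly_of p x
    = \sum_(j < Nfreq d n | (\rank T <= j)%N) usv U j x * ((U ^t*)%sesqui *m p) j 0.
  move=> /vanishP pV; rewrite -[in LHS](mul1mx p) -UU' -mulmxA poly_of_mulmx.
  rewrite [RHS]big_mkcond; apply: eq_bigr => j _.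
  by case: leqP => // /pV ->; rewrite mulr0.
have p0_ge0 x : 0 <= p0 T U x.
  by rewrite mulr_ge0 ?invr_ge0 ?ler0n ?sumr_ge0.
have p0_eq0 x : p0 T U x = 0 ->
    forall j : 'I_(Nfreq d n), (\rank T <= j)%N -> usv U j x = 0.
  move=> /eqP; rewrite mulf_eq0 invr_eq0 gt_eqF//= => /eqP s0 j rj.
  have /eqP := psumr_eq0P (fun i _ => sq0 (usv U i x)) s0 rj.
  by rewrite sqrf_eq0 => /eqP /Normc.eq0_normc.
split=> //.
- move=> x Vx; rewrite -(p01 x) /p0 big1 ?mulr0 ?add0r// => j rj.
  by rewrite usv_V// Normc.normc0 expr0n.
- move=> x nVx; rewrite -(p01 x) ltrDr lt_neqAle p0_ge0 andbT eq_sym.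
  (* If [p0] vanished at x, so would every polynomial vanishing on V, by [poly_tail]; those with
     coefficients in the kernel of [T] are among them, which puts x in V. *)
  apply/eqP => /p0_eq0 u0; apply: nVx; rewrite -zV => p Tp0.
  have pV y : V y -> poly_of p y = 0 by rewrite -zV => /(_ p Tp0).
  by rewrite poly_tail// big1// => j rj; rewrite u0// mul0r.
move=> VT x; rewrite /is_max.
have normp (p : 'cV[R[i]]_(Nfreq d n)) :
    normL2 p ^+ 2 = \sum_j Normc.normc (((U ^t*)%sesqui *m p) j 0) ^+ 2.
  by rewrite normL2E -(unitarymx_normc (((U ^t*)%sesqui *m p)) uU) mulmxA UU' mul1mx.
have norm_ge0 (p : 'cV[R[i]]_(Nfreq d n)) : 0 <= normL2 p ^+ 2 by exact: sqr_ge0.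
split; last first.
  move=> _ [p [p_neq0 pV] <-].
  have p_gt0 : 0 < normL2 p ^+ 2.
    rewrite lt_neqAle norm_ge0 andbT eq_sym; apply: contra p_neq0 => /eqP.
    rewrite normL2E => /(psumr_eq0P (fun i _ => sq0 (p i 0))) p_0.
    apply/eqP/matrixP => k j; rewrite ord1 mxE; apply: Normc.eq0_normc.
    by apply/eqP; rewrite -sqrf_eq0 p_0.
  rewrite invfM mulrA ler_pdivrMr// mulrC /p0 -mulrA ler_pM2l ?invr_gt0//.
  rewrite (poly_tail _ x pV) normp; apply: le_trans (cauchy_schwarz_sum _ _ _) _.
  (* Cauchy-Schwarz leaves the coefficients of index at least the rank; adding the others only
     increases the sum, to the squared norm. *)
  rewrite ler_wpM2l ?sumr_ge0//.
  by rewrite [leRHS](bigID (fun j : 'I__ => (\rank T <= j)%N))/= lerDl sumr_ge0.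
(* When [p0] is 0 at x the extremal vector below is zero, hence not admissible. Any nonzero
   polynomial vanishing on V then attains the value 0, and one exists because V is not the whole
   torus. *)
have [px0|px_neq0] := eqVneq (p0 T U x) 0.
  have [y nVy] : exists y, ~ V y.
    by apply/existsNP => allV; case: VT => _; apply.
  have [p pV py] : exists2 p : 'cV[R[i]]_(Nfreq d n),
      forall z, V z -> poly_of p z = 0 & poly_of p y <> 0.
    apply: contrapT => nex; apply: nVy; rewrite -zV => p Tp.
    apply: contrapT => py.
    by apply: nex; exists p => // z; rewrite -zV => /(_ p Tp).
  exists p; first split => //.
    apply/eqP => p_0; apply: py; rewrite p_0 /poly_of big1// => k _.
    by rewrite mxE mul0r.
  rewrite px0 poly_tail// big1 => [|j rj].
    by rewrite Normc.normc0 expr0n mul0r.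
  by rewrite p0_eq0// mul0r.
(* The equality case of Cauchy-Schwarz: U c is the orthogonal projection of [evec n x] onto the
   polynomials vanishing on V, that is, their reproducing kernel at x. Its value at x and its
   squared norm both equal [S], so the quotient is S / N. *)
pose c : 'cV[R[i]]_(Nfreq d n) :=
  \col_j (if (\rank T <= j)%N then (usv U j x)^* else 0).
pose S := \sum_(j < Nfreq d n | (\rank T <= j)%N) Normc.normc (usv U j x) ^+ 2.
have S_neq0 : S != 0.
  by apply: contra px_neq0 => /eqP S0; rewrite /p0 -/S S0 mulr0.
have Ux : poly_of (U *m c) x = S%:C%C.
  rewrite poly_of_mulmx /S rmorph_sum [RHS]big_mkcond/=; apply: eq_bigr => j _.
  by rewrite mxE; case: ifP; rewrite ?mulr0// => _; rewrite normcJ.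
have normUc : normL2 (U *m c) ^+ 2 = S.
  rewrite normp mulmxA UU mul1mx /S [RHS]big_mkcond; apply: eq_bigr => j _.
  rewrite mxE; case: ifP; rewrite ?Normc.normc0 ?expr0n// => _.
  by rewrite !normcE; case: (usv _ _ _) => a b /=; rewrite sqrrN.
exists (U *m c); first split.
- apply: contra S_neq0 => /eqP Uc0; rewrite -normUc Uc0 normL2E big1// => k _.
  by rewrite mxE Normc.normc0 expr0n.
- by apply: vanish_mul => j rj; rewrite mxE leqNgt rj.
rewrite Ux normUc normcE/= expr0n addr0 /p0 -/S expr2 invfM mulrCA.
by rewrite mulfK.
Qed.
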